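(* An ordinal convex geometry is primitive if and only if its associated partial order is primitive.
   Context: A convex geometry on a finite nonempty set $X$ is a family $\mathcal{G}\subseteq 2^X$ such that: (G1) $\varnothing\in\mathcal{G}$; (G2) if $F,G\in\mathcal{G}$ then $F\cap G\in\mathcal{G}$; (G3) for every $G\in\mathcal{G}\setminus\{X\}$ there is $x\in X\setminus G$ with $G\cup\{x\}\in\mathcal{G}$. The pair $(X,\mathcal{G})$ is also called a convex geometry. For $A\subseteq X$, the convex hull is $\operatorname{conv}_{\mathcal{G}}(A)=\bigcap\{G\in\mathcal{G}: A\subseteq G\}$, and the set of extreme elements of $A$ is $\operatorname{ex}_{\mathcal{G}}(A)=\{a\in A: a\notin\operatorname{conv}_{\mathcal{G}}(A\setminus\{a\})\}$. Resolution of convex geometries: let $(X,\mathcal{G}_X)$ be a convex geometry (the base) and $\{(Y_x,\mathcal{G}_x):x\in X\}$ a family of convex geometries (the fibers), where the sets $Y_x$ are pairwise disjoint and disjoint from $X$. Let $Z=\bigcup_{x\in X}Y_x$ and let $\pi\colon Z\to X$ be the projection given by $\pi(z)=x$ for $z\in Y_x$. The resolution of $(X,\mathcal{G}_X)$ into $\{(Y_x,\mathcal{G}_x):x\in X\}$ is the pair $(Z,\mathcal{G}_Z)$, where $\mathcal{G}_Z$ consists of all $A\subseteq Z$ such that: (R1) $\pi(A)\in\mathcal{G}_X$; (R2) $A\cap Y_x\in\mathcal{G}_x$ for all $x\in\pi(A)$; (R3) $Y_x\subseteq A$ for all $x\in\pi(A)\setminus\operatorname{ex}_{\mathcal{G}_X}(\pi(A))$.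 The resolution is again a convex geometry. Resolution of binary relations: given a finite set $X$ with a binary relation $R_X$ and finite pairwise disjoint sets $Y_x$ ($x\in X$), disjoint from $X$, with binary relations $R_x$ on $Y_x$, the resolution of $(X,R_X)$ into $\{(Y_x,R_x):x\in X\}$ is $(Z,R_Z)$, where $Z=\bigcup_{x\in X}Y_x$ and, for $z,z'\in Z$, $z\,R_Z\,z'$ holds iff either there is $x\in X$ with $z,z'\in Y_x$ and $z\,R_x\,z'$, or there are $x\ne x'$ in $X$ with $z\in Y_x$, $z'\in Y_{x'}$ and $x\,R_X\,x'$. (Base sets and fiber sets are nonempty.) In both settings a resolution is nontrivial if the base and at least one fiber have more than one element. A convex geometry is primitive if it does not equal any nontrivial resolution of convex geometries. A binary relation on a finite set is primitive if it does not equal any nontrivial resolution of binary relations. A convex geometry $(X,\mathcal{G})$ is ordinal if there is a partial order $\le$ on $X$ such that $\mathcal{G}$ is the family of all ideals of $(X,\le)$, i.e. all $G\subseteq X$ such that $x\le y$ and $y\in G$ imply $x\in G$. Such a partial order is unique (namely $x\le y$ iff $x\in\operatorname{conv}_{\mathcal{G}}(\{y\})$) and is called the partial order associated to $\mathcal{G}$. *)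

(* Defs.v *)
From mathcomp Require Import all_boot.

Set Implicit Arguments.
Unset Strict Implicit.
Unset Printing Implicit Defensive.

(* A ground set is a set [X : {set T}] over an ambient finite type, so that the
   fibers of a resolution live in the same ambient type as the resolution. *)

Definition convex_geometry (T : finType) (X : {set T}) (G : {set {set T}}) :
    Prop :=
  [/\ X != set0 /\ G \subset powerset X,
      set0 \in G,
      forall F H, F \in G -> H \in G -> F :&: H \in G
    & forall H, H \in G -> H != X ->
        exists2 x, x \in X :\: H & x |: H \in G].

Definition conv (T : finType) (G : {set {set T}}) (A : {set T}) : {set T} :=
  \bigcap_(H in G | A \subset H) H.

Definition extreme (T : finType) (G : {set {set T}}) (A : {set T}) : {set T} :=
  [set a in A | a \notin conv G (A :\ a)].

(* The base [X] and the fibers [Y x] have different ambient types, hence the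
   base is disjoint from the fibers; [Y x] is only relevant for [x \in X]. *)
Definition fiber_family (B T : finType) (X : {set B}) (Y : B -> {set T}) :
    Prop :=
  [/\ X != set0,
      {in X, forall x, Y x != set0}
    & {in X &, forall x x', x != x' -> [disjoint Y x & Y x']}].

Definition total_set (B T : finType) (X : {set B}) (Y : B -> {set T}) :
    {set T} :=
  \bigcup_(x in X) Y x.

(* The image of [A] under the projection sending each [z \in Y x] to [x]. *)
Definition proj (B T : finType) (X : {set B}) (Y : B -> {set T})
    (A : {set T}) : {set B} :=
  [set x in X | [exists z in A, z \in Y x]].

Definition nontrivial (B T : finType) (X : {set B}) (Y : B -> {set T}) : Prop :=
  1 < #|X| /\ exists2 x, x \in X & 1 < #|Y x|.

Definition geom_resolution (B T : finType) (X : {set B}) (GX : {set {set B}})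
    (Y : B -> {set T}) (GY : B -> {set {set T}}) : {set {set T}} :=
  [set A in powerset (total_set X Y) |
     [&& proj X Y A \in GX,
         [forall x in proj X Y A, A :&: Y x \in GY x]
       & [forall x in proj X Y A :\: extreme GX (proj X Y A), Y x \subset A]]].

Definition primitive_geometry (T : finType) (Z : {set T})
    (G : {set {set T}}) : Prop :=
  ~ exists (B : finType) (X : {set B}) (GX : {set {set B}})
           (Y : B -> {set T}) (GY : B -> {set {set T}}),
      [/\ convex_geometry X GX,
          {in X, forall x, convex_geometry (Y x) (GY x)},
          fiber_family X Y,
          nontrivial X Y
        & Z = total_set X Y /\ G = geom_resolution X GX Y GY].

(* A binary relation on [X : {set T}] is a [rel T] of which only the values on
   [X] are relevant; equality of such relations is agreement on [X]. *)

Definition rel_resolution (B T : finType) (X : {set B}) (RX : rel B)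
    (Y : B -> {set T}) (RY : B -> rel T) : rel T :=
  fun z z' =>
    [exists x in X, [&& z \in Y x, z' \in Y x & RY x z z']]
    || [exists x in X, exists x' in X,
          [&& x != x', z \in Y x, z' \in Y x' & RX x x']].

Definition primitive_relation (T : finType) (Z : {set T}) (R : rel T) : Prop :=
  ~ exists (B : finType) (X : {set B}) (RX : rel B)
           (Y : B -> {set T}) (RY : B -> rel T),
      [/\ fiber_family X Y,
          nontrivial X Y,
          Z = total_set X Y
        & {in Z &, R =2 rel_resolution X RX Y RY}].

Definition partial_order_on (T : finType) (X : {set T}) (le : rel T) : Prop :=
  [/\ {in X, reflexive le},
      {in X &, antisymmetric le}
    & {in X & &, transitive le}].

Definition ideals (T : finType) (X : {set T}) (le : rel T) : {set {set T}} :=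
  [set G in powerset X |
     [forall x in X, forall y in X, le x y && (y \in G) ==> (x \in G)]].

Definition associated_order (T : finType) (X : {set T}) (G : {set {set T}})
    (le : rel T) : Prop :=
  partial_order_on X le /\ G = ideals X le.

Definition ordinal_geometry (T : finType) (X : {set T}) (G : {set {set T}}) :
    Prop :=
  convex_geometry X G /\ exists le : rel T, associated_order X G le.

(* The associated order is unique as a relation on [X]. *)
Lemma associated_orderE (T : finType) (X : {set T}) (G : {set {set T}})
    (le : rel T) :
  associated_order X G le ->
  {in X &, forall x y, le x y = (x \in conv G [set y])}.
Proof.
case=> -[refl_le anti_le trans_le] -> x y xX yX.
apply/idP/bigcapP => [le_xy H /andP[] | /(_ [set u in X | le u y])].
  rewrite inE => /andP[_ /forall_inP/(_ x xX)/forall_inP/(_ y yX)/implyP idH].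
  by rewrite sub1set => yH; apply: idH; rewrite le_xy.
rewrite sub1set !inE yX refl_le // xX /= => -> //; rewrite andbT.
apply/andP; split; first by apply/subsetP=> u; rewrite inE => /andP[].
apply/forall_inP=> u uX; apply/forall_inP=> v vX; apply/implyP.
by rewrite !inE uX vX /= => /andP[]; apply: trans_le.
Qed.

(* Main.v *)
Require Import Defs.
From mathcomp Require Import all_boot.

Set Implicit Arguments.
Unset Strict Implicit.
Unset Printing Implicit Defensive.

(** The two notions of resolution determine each other, with the same base
    set and the same fibers, so nontriviality carries over in both directions.

    From geometries to orders: in a resolution, hulls of points in different
    fibers are governed by the base.  If [x] lies in the hull of [x' != x],
    then [x] is not extreme in any projection containing [x'], so a convex set
    meeting [Y x'] swallows the whole of [Y x]; conversely the union of the
    fibers over the hull of [x'] is convex, so the hull of a point of [Y x']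
    meets no fibers but those.  Hence the relation [z \in conv G [set z']] is the
    resolution of the base relation [x \in conv GX [set x']]
    (lemma [conv1_geom_resolution]).  For an ordinal geometry this relation is
    the associated order.

    From orders to geometries: if a partial order on the total set is a
    resolution, then its base relation, made reflexive, is a partial order,
    because an inequality between distinct points of the base is an inequality
    between all points of the two fibers.  An element of an ideal is extreme
    exactly when it is maximal there, so condition (R3) says that a convex set
    contains each fiber lying below another fiber that it meets; this is what
    being an ideal means across fibers, while (R2) is what it means within one
    fiber (lemma [ideals_rel_resolution]). *)

(** * Hulls and extreme points *)

Lemma mem_conv (T : finType) (G : {set {set T}}) (A : {set T}) x :
  reflect (forall H, H \in G -> A \subset H -> x \in H) (x \in conv G A).
Proof.
apply: (iffP bigcapP) => [xG H HG AH | xG H /andP[]]; last exact: xG.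
by apply: xG; rewrite HG.
Qed.

Lemma sub_conv (T : finType) (G : {set {set T}}) (A : {set T}) :
  A \subset conv G A.
Proof. by apply/subsetP=> x xA; apply/mem_conv=> H _ /subsetP; apply. Qed.

Lemma conv1_notin_extreme (T : finType) (G : {set {set T}}) (A : {set T}) x y :
  y \in A -> x != y -> x \in conv G [set y] -> x \notin extreme G A.
Proof.
move=> yA nxy /mem_conv xGy; rewrite inE negb_and negbK; apply/orP; right.
apply/mem_conv=> H HG /subsetP AH; apply: xGy => //.
by rewrite sub1set AH // in_setD1 eq_sym nxy.
Qed.

Section ConvexGeometry.

Variables (T : finType) (X : {set T}) (G : {set {set T}}).
Hypothesis geomG : convex_geometry X G.

Lemma convex_sub H : H \in G -> H \subset X.
Proof. by case: geomG => -[_ /subsetP sGX] _ _ _ /sGX; rewrite powersetE. Qed.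

(** A convex set of maximal size cannot be enlarged by one point. *)
Lemma full_convex : X \in G.
Proof.
case: (geomG) => _ G0 _ extG.
case: (arg_maxnP (fun H : {set T} => #|H|) G0) => H HG maxH.
have [<- // | /(extG H HG)[x /setDP[_ xH] xHG]] := eqVneq H X.
by have := maxH _ xHG; rewrite cardsU1 xH /= add1n ltnn.
Qed.

Lemma conv_convex (A : {set T}) : A \subset X -> conv G A \in G.
Proof.
case: (geomG) => _ _ capG _ AX.
have convE : conv G A = X :&: conv G A.
  apply/esym/setIidPr/subsetP=> x /mem_conv; apply=> //; exact: full_convex.
rewrite convE /conv; elim/big_rec: _ => [|H K /andP[HG _] KG].
  by rewrite setIT full_convex.
by rewrite setICA capG.
Qed.

End ConvexGeometry.

(** * Ideals of a partial order *)

Section Ideals.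

Variables (T : finType) (X : {set T}) (le : rel T).

Lemma mem_ideals (A : {set T}) :
  reflect (A \subset X /\
           forall x y, x \in X -> le x y -> y \in A -> x \in A)
          (A \in ideals X le).
Proof.
rewrite inE powersetE; apply: (iffP andP) => -[AX idA]; split=> //.
  move=> x y xX le_xy yA; have yX := subsetP AX y yA.
  move/forall_inP/(_ x xX)/forall_inP/(_ y yX): idA.
  by rewrite le_xy yA.
apply/forall_inP=> x xX; apply/forall_inP=> y _; apply/implyP=> /andP[].
exact: idA.
Qed.

Hypothesis ordX : partial_order_on X le.

(** The elements of [X] below some element of [A] form an ideal
    containing [A]. *)
Lemma conv_ideals (A : {set T}) x :
  A \subset X -> x \in conv (ideals X le) A -> exists2 y, y \in A & le x y.
Proof.
case: ordX => refl_le _ trans_le AX /mem_conv.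
move=> /(_ [set u in X | [exists y in A, le u y]]) xI.
suff: x \in [set u in X | [exists y in A, le u y]].
  by rewrite inE => /andP[_ /exists_inP].
apply: xI; last first.
  apply/subsetP=> y yA; have yX := subsetP AX y yA.
  by rewrite inE yX; apply/exists_inP; exists y; rewrite ?refl_le.
apply/mem_ideals; split=> [|u v uX le_uv].
  by apply/subsetP=> u; rewrite inE => /andP[].
rewrite !inE uX => /andP[vX /exists_inP[y yA le_vy]].
apply/exists_inP; exists y => //.
exact: (trans_le v u y vX uX (subsetP AX y yA)).
Qed.

Lemma notin_extreme_ideals (A : {set T}) x :
  A \subset X -> x \in A -> x \notin extreme (ideals X le) A ->
  exists2 y, y \in A :\ x & le x y.
Proof.
move=> AX xA; rewrite inE xA negbK; apply: conv_ideals.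
by rewrite (subset_trans _ AX) // subD1set.
Qed.

(** An ideal is enlarged by a minimal element of its complement; having the
    fewest elements below it makes an element minimal. *)
Lemma ideals_convex_geometry : X != set0 -> convex_geometry X (ideals X le).
Proof.
case: (ordX) => refl_le anti_le trans_le X0; split.
- by split=> //; apply/subsetP=> A /mem_ideals[]; rewrite powersetE.
- by apply/mem_ideals; split=> [|x y _ _]; rewrite ?sub0set ?inE.
- move=> F H /mem_ideals[FX idF] /mem_ideals[_ idH]; apply/mem_ideals.
  split=> [|x y xX le_xy]; first by rewrite subIset // FX.
  by rewrite !inE => /andP[/(idF x y xX le_xy)-> /(idH x y xX le_xy)].
move=> H /mem_ideals[HX idH] nHX.
have /set0Pn[x0 x0P] : X :\: H != set0.
  by rewrite setD_eq0; apply: contraNN nHX; rewrite eqEsubset HX.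
pose below x := [set u in X | le u x].
case: (arg_minnP (fun x => #|below x|) x0P) => x xP minx; exists x => //.
case/setDP: xP => xX xH; apply/mem_ideals; split=> [|u v uX le_uv].
  by rewrite subUset sub1set xX.
rewrite !inE => /orP[/eqP vx | vH]; last by rewrite (idH u v) ?orbT.
rewrite {v}vx in le_uv; apply/norP=> -[nux uH].
have : #|below u| < #|below x|.
  apply/proper_card/properP; split.
    apply/subsetP=> w; rewrite !inE => /andP[wX le_wu]; rewrite wX /=.
    exact: (trans_le u w x).
  exists x; first by rewrite inE xX refl_le.
  rewrite inE xX /=; apply: contra nux => le_xu.
  by apply/eqP/anti_le => //; rewrite le_uv.
have uP : u \in X :\: H by rewrite in_setD uH.
by rewrite ltnNge (minx u uP).
Qed.

End Ideals.

Lemma sub_partial_order (T : finType) (X Z : {set T}) (le : rel T) :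
  X \subset Z -> partial_order_on Z le -> partial_order_on X le.
Proof.
move=> /subsetP XZ [refl_le anti_le trans_le].
by split; [apply: sub_in1 refl_le | apply: sub_in2 anti_le
          | apply: sub_in3 trans_le].
Qed.

(** * Resolutions *)

Section Resolution.

Variables (B T : finType) (X : {set B}) (Y : B -> {set T}).
Hypothesis famY : fiber_family X Y.

Lemma fiber_inj x x' z :
  x \in X -> x' \in X -> z \in Y x -> z \in Y x' -> x = x'.
Proof.
case: famY => _ _ disjY xX x'X zx zx'; apply/eqP; case: eqVneq => // nxx'.
by have /disjointFr/(_ zx) := disjY _ _ xX x'X nxx'; rewrite zx'.
Qed.

Lemma fiber_sub_total x : x \in X -> Y x \subset total_set X Y.
Proof. exact: bigcup_sup. Qed.

Lemma mem_proj (A : {set T}) x :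
  reflect (x \in X /\ exists2 z, z \in A & z \in Y x) (x \in proj X Y A).
Proof. by rewrite inE; apply: (iffP andP) => -[-> /exists_inP]. Qed.

Lemma proj_total (C : {set B}) : C \subset X -> proj X Y (total_set C Y) = C.
Proof.
case: (famY) => _ Y0 _ CX; apply/setP=> x; apply/mem_proj/idP.
  case=> xX [z /bigcupP[c cC zc] zx].
  by rewrite (fiber_inj xX (subsetP CX c cC) zx zc).
move=> xC; have xX := subsetP CX x xC; split=> //.
have /set0Pn[z zx] := Y0 x xX.
by exists z => //; apply/bigcupP; exists x.
Qed.

Lemma mem_geom_resolution (GX : {set {set B}}) (GY : B -> {set {set T}})
    (A : {set T}) :
  reflect [/\ A \subset total_set X Y,
              proj X Y A \in GX,
              forall x, x \in proj X Y A -> A :&: Y x \in GY x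
            & forall x, x \in proj X Y A -> x \notin extreme GX (proj X Y A) ->
                Y x \subset A]
          (A \in geom_resolution X GX Y GY).
Proof.
rewrite inE powersetE; apply: (iffP and4P) => -[sA R1 R2 R3]; split=> //.
- by move=> x xA; apply: (forall_inP R2).
- by move=> x xA exx; apply: (forall_inP R3); rewrite inE exx.
- exact/forall_inP.
by apply/forall_inP=> x /setDP[xA exx]; apply: R3.
Qed.

Lemma rel_resolutionE (RX : rel B) (RY : B -> rel T) x x' z z' :
  x \in X -> x' \in X -> z \in Y x -> z' \in Y x' ->
  rel_resolution X RX Y RY z z' = if x == x' then RY x z z' else RX x x'.
Proof.
move=> xX x'X zx z'x'; apply/orP/idP.
  case=> [/exists_inP[u uX /and3P[zu z'u]] |].
    by rewrite (fiber_inj xX uX zx zu) (fiber_inj x'X uX z'x' z'u) eqxx.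
  case/exists_inP=> u uX /exists_inP[u' u'X /and4P[nuu' zu z'u']].
  rewrite (fiber_inj xX uX zx zu) (fiber_inj x'X u'X z'x' z'u').
  by rewrite (negbTE nuu').
case: eqVneq => [xx' | nxx'] R.
  by left; apply/exists_inP; exists x; rewrite // zx xx' z'x' -xx'.
right; apply/exists_inP; exists x => //; apply/exists_inP; exists x' => //.
exact/and4P.
Qed.

Lemma total_convex (GX : {set {set B}}) (GY : B -> {set {set T}})
    (C : {set B}) :
    convex_geometry X GX -> {in X, forall x, convex_geometry (Y x) (GY x)} ->
  C \in GX -> total_set C Y \in geom_resolution X GX Y GY.
Proof.
move=> geomX geomY CG; have CX := convex_sub geomX CG.
have sub_total x : x \in C -> Y x \subset total_set C Y by apply: bigcup_sup.
apply/mem_geom_resolution; rewrite proj_total //; split=> // [|x xC|x xC _].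
- by apply/bigcupsP=> x xC; apply: fiber_sub_total; apply: (subsetP CX).
- rewrite (setIidPr (sub_total x xC)).
  exact: full_convex (geomY x (subsetP CX x xC)).
exact: sub_total.
Qed.

(** Between distinct fibers, the hull of a point depends only on the hull of
    its projection; within a fiber there is nothing to compare, since the
    fiber relation is taken to be the hull relation itself. *)
Lemma conv1_geom_resolution (GX : {set {set B}}) (GY : B -> {set {set T}}) :
    convex_geometry X GX -> {in X, forall x, convex_geometry (Y x) (GY x)} ->
  let hull z z' := z \in conv (geom_resolution X GX Y GY) [set z'] in
  {in total_set X Y &,
    hull =2 rel_resolution X (fun x x' => x \in conv GX [set x'])
                           Y (fun _ => hull)}.
Proof.
move=> geomX geomY hull z z' /bigcupP[x xX zx] /bigcupP[x' x'X z'x'].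
rewrite (rel_resolutionE _ _ xX x'X zx z'x'); case: eqVneq => // nxx'.
have sx'X : [set x'] \subset X by rewrite sub1set.
apply/idP/idP => [/mem_conv hz | hx].
  have convG := conv_convex geomX sx'X.
  have : z \in total_set (conv GX [set x']) Y.
    apply: hz; first exact: total_convex.
    rewrite sub1set; apply/bigcupP; exists x' => //.
    by rewrite (subsetP (sub_conv _ _)) ?set11.
  case/bigcupP=> c cC zc.
  by rewrite (fiber_inj xX (subsetP (convex_sub geomX convG) c cC) zx zc).
apply/mem_conv=> A /mem_geom_resolution[_ R1 _ R3]; rewrite sub1set => z'A.
have x'A : x' \in proj X Y A by apply/mem_proj; split=> //; exists z'.
have xA : x \in proj X Y A by move/mem_conv: hx; apply; rewrite ?sub1set.
by apply: (subsetP (R3 x xA _)) zx; apply: conv1_notin_extreme x'A nxx' hx.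
Qed.

Section Order.

Variables (le : rel T) (RX : rel B) (RY : B -> rel T).
Hypothesis ordZ : partial_order_on (total_set X Y) le.
Hypothesis leE : {in total_set X Y &, le =2 rel_resolution X RX Y RY}.

(** Only the off-diagonal values of [RX] matter in the resolution, hence [RX]
    itself need not be reflexive. *)
Definition base_order : rel B := fun x x' => (x == x') || RX x x'.

Lemma le_base x x' z z' :
  x \in X -> x' \in X -> z \in Y x -> z' \in Y x' -> x != x' ->
  le z z' = base_order x x'.
Proof.
move=> xX x'X zx z'x' nxx'.
rewrite leE ?(subsetP (fiber_sub_total _) _ zx) //; last first.
  exact: (subsetP (fiber_sub_total x'X)).
by rewrite (rel_resolutionE _ _ xX x'X zx z'x') /base_order (negbTE nxx').
Qed.

(** Antisymmetry and transitivity are read off from representatives chosen in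
    the fibers. *)
Lemma base_partial_order : partial_order_on X base_order.
Proof.
case: (famY) (ordZ) => _ Y0 _ [_ anti_le trans_le].
have total x z : x \in X -> z \in Y x -> z \in total_set X Y.
  by move=> xX; apply: (subsetP (fiber_sub_total xX)).
have anti : {in X &, antisymmetric base_order}.
  move=> x x' xX x'X; case: (eqVneq x x') => // nxx'.
  have [/set0Pn[z zx] /set0Pn[z' z'x']] := (Y0 x xX, Y0 x' x'X).
  rewrite -(le_base xX x'X zx z'x') //.
  rewrite -(le_base x'X xX z'x' zx) 1?eq_sym // => le_zz'.
  have zz' : z = z'.
    by apply: anti_le le_zz'; [apply: total zx | apply: total z'x'].
  by apply: (fiber_inj xX x'X zx); rewrite zz'.
split=> [x _ | // | y x w yX xX wX]; first by rewrite /base_order eqxx.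
case: (eqVneq x y) => [-> // | nxy] Rxy.
case: (eqVneq y w) => [<- // | nyw] Ryw.
case: (eqVneq x w) => [-> | nxw]; first by rewrite /base_order eqxx.
have [/set0Pn[a ax] /set0Pn[b b_y]] := (Y0 x xX, Y0 y yX).
have /set0Pn[c cw] := Y0 w wX.
rewrite -(le_base xX wX ax cw nxw).
apply: (trans_le b); rewrite ?(total _ _ yX b_y) ?(total _ _ xX ax) //.
- exact: total cw.
- by rewrite (le_base xX yX ax b_y nxy).
by rewrite (le_base yX wX b_y cw nyw).
Qed.

Lemma ideals_rel_resolution :
  ideals (total_set X Y) le =
  geom_resolution X (ideals X base_order) Y (fun x => ideals (Y x) le).
Proof.
case: (famY) => _ Y0 _; have ordX := base_partial_order.
apply/setP=> A; apply/mem_ideals/mem_geom_resolution.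
  case=> AZ idA.
  have below x y : x \in X -> y \in proj X Y A -> x != y -> base_order x y ->
      Y x \subset A.
    move=> xX /mem_proj[yX [b bA b_y]] nxy Rxy; apply/subsetP=> a ax.
    apply: (idA a b) => //; first exact: (subsetP (fiber_sub_total xX)).
    by rewrite (le_base xX yX ax b_y nxy).
  have pAX : proj X Y A \subset X by apply/subsetP=> x /mem_proj[].
  split=> // [|x xA|x xA exx].
  - apply/mem_ideals; split=> // x y xX Rxy yA.
    case: (eqVneq x y) => [-> // | nxy].
    have /set0Pn[a ax] := Y0 x xX.
    apply/mem_proj; split=> //; exists a => //.
    exact: (subsetP (below x y xX yA nxy Rxy)).
  - apply/mem_ideals; split=> [|a b ax le_ab]; first exact: subsetIr.
    rewrite !inE ax andbT => /andP[bA _]; apply: (idA a b) => //.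
    by apply: subsetP ax; apply: fiber_sub_total; apply: (subsetP pAX).
  have [y /setD1P[nyx yA] Rxy] := notin_extreme_ideals ordX pAX xA exx.
  by apply: below yA _ Rxy; rewrite ?(subsetP pAX) // eq_sym.
case=> AZ R1 R2 R3; split=> // a b aZ le_ab bA.
case/bigcupP: (aZ) => x xX ax.
case/bigcupP: (subsetP AZ b bA) => y yX b_y.
have yA : y \in proj X Y A by apply/mem_proj; split=> //; exists b.
case: (eqVneq x y) => [xy | nxy].
  rewrite xy in ax; have /mem_ideals[_ idY] := R2 y yA.
  have : a \in A :&: Y y by apply: (idY a b); rewrite // inE bA.
  by case/setIP.
have Rxy : base_order x y by rewrite -(le_base xX yX ax b_y nxy).
have xA : x \in proj X Y A by case/mem_ideals: R1 => _ idX; apply: (idX x y).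
apply: (subsetP (R3 x xA _)) ax; apply: conv1_notin_extreme yA nxy _.
by rewrite -(associated_orderE (conj ordX (erefl _))).
Qed.

End Order.

End Resolution.

Theorem corollary4p15 (T : finType) (X : {set T}) (G : {set {set T}})
    (hG : ordinal_geometry X G)
    (le : rel T) (hle : associated_order X G le) :
  primitive_geometry X G <-> primitive_relation X le.
Proof.
case: (hle) => ordX defG; split=> prim.
  case=> B [X0 [RX [Y [RY [famY ntY defX leE]]]]]; apply: prim.
  case: (famY) => X00 Y0 _; rewrite defX in ordX leE defG.
  exists B, X0, (ideals X0 (base_order RX)), Y, (fun x => ideals (Y x) le).
  split=> // [|x xX0|].
  - exact: ideals_convex_geometry (base_partial_order famY ordX leE) X00.
  - apply: ideals_convex_geometry; last exact: Y0.
    exact: sub_partial_order (fiber_sub_total _ xX0) ordX.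
  by split=> //; rewrite defG; apply: ideals_rel_resolution leE.
case=> B [X0 [GX [Y [GY [geomX geomY famY ntY [defX defR]]]]]]; apply: prim.
pose hull z z' := z \in conv G [set z'].
exists B, X0, (fun x x' => x \in conv GX [set x']), Y, (fun _ => hull).
split=> // z z' zX z'X.
rewrite (associated_orderE hle) //; rewrite defX in zX z'X.
by rewrite /hull defR; apply: conv1_geom_resolution.
Qed.
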